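(* Let $\mathscr{B}\subset\mathbb{N}\setminus\{1\}$ be primitive, and assume that $\mathscr{B}$ is taut and infinite. If $\mathscr{B}$ is not Erdős then $\widetilde{X}_\eta\subsetneq X_{\mathscr{B}}$, where $\eta=\mathbf{1}_{\mathcal{F}_{\mathscr{B}}}$.
   Context: $\mathbb{N}=\{1,2,\ldots\}$. $\mathscr{B}$ is primitive if no element of $\mathscr{B}$ divides a different element of $\mathscr{B}$. $\mathcal{F}_{\mathscr{B}}=\mathbb{Z}\setminus\bigcup_{b\in\mathscr{B}}b\mathbb{Z}$. The logarithmic density of $A$ is $\delta(A)=\lim_{n\to\infty}\frac{1}{\log n}\sum_{j\in A,\,1\le j\le n}\frac1j$ (it always exists for $A=\mathcal{F}_{\mathscr{B}}$, by the Davenport-Erdős theorem). $\mathscr{B}$ is taut if $\delta(\mathcal{F}_{\mathscr{B}})<\delta(\mathcal{F}_{\mathscr{B}\setminus\{b\}})$ for every $b\in\mathscr{B}$. $\mathscr{B}$ is Erdős if it is infinite, pairwise coprime, and $\sum_{b\in\mathscr{B}}1/b<\infty$. $S$ is the left shift on $\{0,1\}^{\mathbb{Z}}$ and $X_\eta:=\overline{\{S^j\eta:j\in\mathbb{Z}\}}$. A subshift $X\subset\{0,1\}^{\mathbb{Z}}$ is hereditary if $x\in X$ and $y\le x$ coordinatewise imply $y\in X$; $\widetilde{X}_\eta$ is the smallest hereditary subshift containing $X_\eta$. $X_{\mathscr{B}}$ is the set of all $x\in\{0,1\}^{\mathbb{Z}}$ whose support misses at least one residue class modulo $b$, for every $b\in\mathscr{B}$.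 *)

(* Defs.v *)
From mathcomp Require Import all_boot all_order all_algebra.
From mathcomp Require Import all_classical all_reals all_analysis.

Set Implicit Arguments.
Unset Strict Implicit.
Unset Printing Implicit Defensive.

Import Order.TTheory GRing.Theory Num.Theory.
Import numFieldNormedType.Exports.

Local Open Scope classical_set_scope.
Local Open Scope ring_scope.

Definition primitive (B : set nat) : Prop :=
  forall a b : nat, B a -> B b -> (a %| b)%N -> a = b.

Definition free_set (B : set nat) : set int :=
  ~` \bigcup_(b in B) [set n : int | (b%:Z %| n)%Z].

(* [lim] is total: it takes a default value when the limit does not exist.
   For the sets [free_set B] it exists by the Davenport-Erdos theorem. *)
Definition log_density (R : realType) (A : set int) : R :=
  lim ((fun n : nat =>
    (ln n%:R)^-1 * \sum_(1 <= j < n.+1 | j%:Z \in A) (j%:R : R)^-1) @ \oo).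

Definition taut (R : realType) (B : set nat) : Prop :=
  forall b : nat, B b ->
    log_density R (free_set B) < log_density R (free_set (B `\ b)).

Definition erdos (R : realType) (B : set nat) : Prop :=
  [/\ infinite_set B,
      (forall a b : nat, B a -> B b -> a != b -> coprime a b) &
      (\esum_(b in B) ((b%:R : R)^-1)%:E < +oo)%E].

(* {0,1}^Z with the product of the discrete topologies. *)
Definition config : topologicalType := prod_topology (fun _ : int => bool).

(* The power S^j of the left shift; S itself is [shiftZ 1]. *)
Definition shiftZ (j : int) (x : config) : config := fun n : int => x (n + j).

Definition orbit_closure (x : config) : set config :=
  closure [set shiftZ j x | j in [set: int]].

Definition subshift (X : set config) : Prop :=
  closed X /\ shiftZ 1 @` X = X.

Definition hereditary (X : set config) : Prop :=
  forall x y : config, X x -> (forall n : int, (y n <= x n)%O) -> X y.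

Definition hereditary_closure (X : set config) : set config :=
  smallest [set Y | subshift Y /\ hereditary Y] X.

Definition eta (B : set nat) : config := fun n : int => n \in free_set B.

Definition admissible (B : set nat) : set config :=
  [set x : config | forall b : nat, B b ->
     exists r : int, forall n : int, x n -> (n != r %[mod b%:Z])%Z].

(* Main.v *)
Require Import Defs.
From mathcomp Require Import all_boot all_order all_algebra.
From mathcomp Require Import all_classical all_reals all_analysis.
From mathcomp Require Import lra.

Import Order.TTheory GRing.Theory Num.Theory.
Import numFieldNormedType.Exports.

Local Open Scope classical_set_scope.
Local Open Scope ring_scope.

(* If B is pairwise coprime but not Erdos, then the sum of 1/b diverges and both
   F_B and F_{B \ {b}} have logarithmic density 0, against tautness.

   Otherwise some a <> b in B have a common factor, and, up to exchanging them,
   b has a divisor q that does not divide a and is not a multiple of gcd(a, b).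
   Choose a finite A of at most a + b integers that meets all classes mod a
   except 0 and all classes mod b except q.  If k + A were contained in F_B,
   then -k would be 0 mod a and q mod b, which is impossible since gcd(a, b)
   does not divide q.  Yet A can be chosen so that every c <= a + b dividing an
   element of A divides a or b; as B is primitive, A then misses 0 mod c for all
   such c in B other than a and b, and it misses a class mod each c > a + b by
   cardinality.  So the indicator of A is in X_B, while the configurations
   dominating no translate of A form a hereditary subshift containing eta. *)

(** * Residues, divisors and the finite pattern *)

(** Take for [k] the part of [M] built from the primes not dividing [u]. A prime of [M] that divides
    [u] divides neither [v] nor [k]; any other prime of [M] divides [k] but not [u]. Neither kind
    divides [u + v * k]. *)
Lemma coprime_in_progression (u v M : nat) :
  (0 < u)%N -> (0 < M)%N -> coprime u v ->
  exists k, coprime (u + v * k)%N M.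
Proof.
move=> u0 M0 cuv; set k := (M`_(\pi(u)^'))%N; exists k.
have k0 : (0 < k)%N by apply: part_gt0.
have uk0 : (0 < u + v * k)%N by rewrite addn_gt0 u0.
rewrite coprime_sym coprime_has_primes //.
apply/hasPn => p; rewrite !mem_primes => /and3P[pp _ pdvd]; rewrite M0 pp /=.
apply/negP => pM.
case pu: (p %| u)%N.
  move: pdvd; rewrite dvdn_addr // Euclid_dvdM // => /orP[pv|pk].
    have : (p %| gcdn u v)%N by rewrite dvdn_gcd pu pv.
    by rewrite (eqP cuv) dvdn1 => /eqP p1; move: pp; rewrite p1.
  have : p \in \pi(k) by rewrite mem_primes pp k0.
  by rewrite pi_of_part // !inE /= mem_primes (mem_primes p u) pp u0 pu andbF.
have pk : p \in \pi(k).
  by rewrite pi_of_part // !inE /= mem_primes (mem_primes p u) pp u0 pu M0 pM.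
move: pdvd; rewrite dvdn_addl ?pu //.
by apply: dvdn_mull; move: pk; rewrite mem_primes => /and3P[].
Qed.

(** Dividing [i + a] and [a] by their gcd [g] leaves coprime [u] and [v]. If [u + v * k] is coprime
    to [M], its product with [g] lies in the class of [i], and only [g], a divisor of [a],
    contributes to the gcd with [M]. *)
Lemma lift_residue (a i M : nat) : (0 < a)%N -> (0 < M)%N ->
  exists n, n = i %[mod a] /\ (gcdn n M %| a)%N.
Proof.
(* Using [i + a] rather than [i] keeps [u] positive when [i = 0]. *)
move=> a0 M0; set g := gcdn (i + a) a.
have g0 : (0 < g)%N by rewrite gcdn_gt0 a0 orbT.
have /dvdnP[u ug] : (g %| i + a)%N by apply: dvdn_gcdl.
have /dvdnP[v vg] : (g %| a)%N by apply: dvdn_gcdr.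
have cuv : coprime u v.
  by rewrite /coprime -(eqn_pmul2r g0) muln_gcdl -ug -vg mul1n.
have u0 : (0 < u)%N by move: (ltn_addl i a0); rewrite ug; case: (u).
have [k ck] := coprime_in_progression _ _ _ u0 M0 cuv.
exists ((u + v * k) * g)%N; split.
  by rewrite mulnDl -ug mulnAC -vg -addnA -mulnS addnC mulnC modnMDl.
rewrite gcdnC Gauss_gcdr 1?coprime_sym//.
by apply: dvdn_trans (dvdn_gcdr _ _) (dvdn_gcdr _ _).
Qed.

(** The candidates for [q] are a primary part of [b] not dividing [a] and one of [a] not dividing
    [b]. They belong to distinct primes, so they are coprime and the nontrivial gcd of [a] and [b]
    cannot divide both. *)
Lemma separating_divisor (a b : nat) : (0 < a)%N -> (0 < b)%N ->
  ~~ (a %| b)%N -> ~~ (b %| a)%N -> ~~ coprime a b ->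
  (exists q, [/\ q %| b, ~~ (q %| a) & ~~ (gcdn a b %| q)]%N) \/
  (exists q, [/\ q %| a, ~~ (q %| b) & ~~ (gcdn b a %| q)]%N).
Proof.
move=> a0 b0 nab nba ncop.
have ex x y : (0 < x)%N -> ~~ (x %| y)%N ->
    exists p, [/\ p \in \pi(x) & ~~ (x`_p %| y)%N].
  move=> x0; apply: contraNP => H; apply/(dvdn_partP _ x0) => p px.
  by apply: contrapT => /negP H'; apply: H; exists p.
have [p [pb pna]] := ex _ _ b0 nba; have [p' [pa pnb]] := ex _ _ a0 nab.
case gp: (gcdn a b %| b`_p)%N; last first.
  by left; exists (b`_p)%N; rewrite dvdn_part pna gp.
case gp': (gcdn a b %| a`_p')%N; last first.
  by right; exists (a`_p')%N; rewrite dvdn_part pnb gcdnC gp'.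
(* For equal primes, the part with the smaller exponent would divide the other number. *)
have pp' : p != p'.
  apply/eqP => epp; subst p'.
  move: pna; rewrite p_part => /negP pna; move: pnb; rewrite p_part => /negP pnb.
  case/orP: (leq_total (logn p a) (logn p b)) => l.
    by apply: pnb; apply: dvdn_trans (dvdn_exp2l p l) (pfactor_dvdnn p b).
  by apply: pna; apply: dvdn_trans (dvdn_exp2l p l) (pfactor_dvdnn p a).
have pp0 x y : x \in \pi(y) -> prime x by rewrite mem_primes => /and3P[].
have cpp : coprime (b`_p)%N (a`_p')%N.
  rewrite !p_part coprimeXl // coprimeXr // prime_coprime ?(pp0 _ _ pb)//.
  by rewrite dvdn_prime2 ?(pp0 _ _ pb) ?(pp0 _ _ pa).
have : (gcdn a b %| gcdn b`_p a`_p')%N by rewrite dvdn_gcd gp gp'.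
by rewrite (eqP cpp) dvdn1 => cab; move: ncop; rewrite /coprime cab.
Qed.

(** [A] lifts the nonzero classes mod [a] and the classes mod [b] other than that of [q]. Since [M]
    is the factorial of [a + b], a divisor [c <= a + b] of a lift divides the gcd of the lift with
    [M], hence the modulus of that lift. *)
Lemma obstructing_pattern (a b q : nat) :
  (0 < a)%N -> (0 < b)%N -> ~~ (a %| b)%N ->
  (q %| b)%N -> ~~ (q %| a)%N -> ~~ (gcdn a b %| q)%N ->
  exists A : seq nat,
    [/\ (size A <= a + b)%N,
        {in A, forall n, ~~ (a %| n)%N},
        {in A, forall n, (n != q %[mod b])%N},
        {in A, forall n c, (0 < c <= a + b)%N -> (c %| n)%N ->
           (c %| a)%N || (c %| b)%N} &
        forall k : int, exists2 n : nat, n \in A &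
          (a%:Z %| k + n%:Z)%Z || (b%:Z %| k + n%:Z)%Z].
Proof.
move=> a0 b0 nab qb nqa ngq; set M := ((a + b)`!)%N.
have M0 : (0 < M)%N by apply: fact_gt0.
have dM c : (0 < c <= a + b)%N -> (c %| M)%N by move=> ?; exact: dvdn_fact.
have /choice[f fP] := fun i => lift_residue a i M a0 M0.
have /choice[g gP] := fun i => lift_residue b i M b0 M0.
have fd i c : (0 < c <= a + b)%N -> (c %| f i)%N -> (c %| a)%N.
  by move=> cab cf; apply: dvdn_trans (fP i).2; rewrite dvdn_gcd cf dM.
have gd i c : (0 < c <= a + b)%N -> (c %| g i)%N -> (c %| b)%N.
  by move=> cab cf; apply: dvdn_trans (gP i).2; rewrite dvdn_gcd cf dM.
pose s1 := [seq i <- iota 0 a | (0 < i)%N].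
pose s2 := [seq j <- iota 0 b | (j != q %[mod b])%N].
have zr (c n : nat) (k : int) : (0 < c)%N -> (n = `|((- k) %% c)%Z|%N %[mod c])%N ->
    (c%:Z %| k + n%:Z)%Z.
  move=> c0 e; rewrite addrC -[k]opprK -eqz_mod_dvd; apply/eqP.
  have c0' : c%:Z != 0 by rewrite eqz_nat -lt0n.
  move: (congr1 Posz e); rewrite -!modz_nat => ->.
  by rewrite gez0_abs ?modz_ge0 // modz_mod.
have res_lt (c : nat) (k : int) : (0 < c)%N -> (`|((- k) %% c)%Z| < c)%N.
  move=> c0; rewrite -ltz_nat gez0_abs ?ltz_pmod ?modz_ge0 //.
  by rewrite eqz_nat -lt0n.
exists (map f s1 ++ map g s2); split.
- rewrite size_cat !size_map leq_add // size_filter.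
  + by apply: leq_trans (count_size _ _) _; rewrite size_iota.
  + by apply: leq_trans (count_size _ _) _; rewrite size_iota.
- move=> n; rewrite mem_cat => /orP[] /mapP[i]; rewrite mem_filter mem_iota => /andP[i1 i2] ->.
    by rewrite /dvdn (fP i).1 modn_small // -lt0n.
  by apply: contra nab => /gd; apply; rewrite a0 leq_addr.
- move=> n; rewrite mem_cat => /orP[] /mapP[i]; rewrite mem_filter mem_iota => /andP[i1 i2] ->.
    (* As [q] divides [b], a lift congruent to [q] mod [b] is a multiple of [q]; being a lift mod
       [a], it would force [q] to divide [a]. *)
    apply: contra nqa => /eqP e; apply: (fd i); last first.
      by rewrite /dvdn -(modn_dvdm _ qb) e modn_dvdm // modnn.
    by rewrite (dvdn_gt0 b0 qb) (leq_trans (dvdn_leq b0 qb)) // leq_addl.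
  by rewrite (gP i).1.
- move=> n nA c cab cn; move: nA cn.
  by rewrite mem_cat => /orP[] /mapP[i _ ->]; [move=> /fd -> |move=> /gd ->]; rewrite ?orbT.
(* The aim is an element of [A] congruent to [-k] mod [a] or mod [b]; the class mod [a] serves
   unless [a] divides [k]. *)
move=> k; case ak: (a%:Z %| k)%Z; last first.
  pose i := `|((- k) %% a)%Z|%N.
  exists (f i); last by rewrite zr // (fP i).1.
  rewrite mem_cat map_f // mem_filter mem_iota /= add0n res_lt // andbT absz_gt0.
  by apply/negP => /eqP/dvdz_mod0P; rewrite dvdzE abszN -dvdzE ak.
pose j := `|((- k) %% b)%Z|%N.
exists (g j); last by rewrite [X in _ || X]zr ?orbT // (gP j).1.
rewrite mem_cat (map_f g) ?orbT // mem_filter mem_iota /= add0n res_lt // andbT.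
(* If [-k] were [q] mod [b], the gcd of [a] and [b] would divide both [k] and [k + q], hence [q]. *)
apply: contra ngq => /eqP e.
have : (b%:Z %| k + q%:Z)%Z by apply: zr => //; rewrite -e.
have gk : ((gcdn a b)%:Z %| k)%Z by apply: dvdz_trans ak; rewrite dvdzE /= dvdn_gcdl.
have gb : ((gcdn a b)%:Z %| b%:Z)%Z by rewrite dvdzE /= dvdn_gcdr.
by move=> /(dvdz_trans gb); rewrite rpredDl // dvdzE.
Qed.

(** * Logarithmic density zero for divergent coprime sets *)

Definition multiple_free (s : seq nat) (j : nat) : bool :=
  all (fun c => ~~ (c %| j)%N) s.

Definition free_log_sum (R : realType) (s : seq nat) (n : nat) : R :=
  \sum_(1 <= j < n.+1 | multiple_free s j) j%:R^-1.

Lemma ler_sum_subseq (R : realType) (F : nat -> R) (r r' : seq nat) :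
  (forall i, 0 <= F i) -> uniq r -> uniq r' -> {subset r <= r'} ->
  \sum_(i <- r) F i <= \sum_(i <- r') F i.
Proof.
move=> F0 ur ur' sub; rewrite [leRHS](bigID (mem r)) /= -[X in _ <= X + _]big_filter.
rewrite (perm_big [seq i <- r' | i \in r]) /= ?lerDl ?sumr_ge0 //.
apply: uniq_perm; rewrite ?filter_uniq // => i.
by rewrite mem_filter; case ir: (i \in r) => //=; rewrite sub.
Qed.

(* If j is not divisible by c nor by any element of s, then j and c * j are both
   s-free, and c * j is not of the first kind. *)
Lemma free_log_sum_cons (R : realType) (c : nat) (s : seq nat) (n : nat) :
  (1 < c)%N -> all (coprime c) s ->
  (1 + c%:R^-1) * free_log_sum R (c :: s) n <= free_log_sum R s (c * n).
Proof.
move=> c1 cs; pose r := [seq j <- index_iota 1 n.+1 | multiple_free (c :: s) j].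
have c0 : (0 < c)%N by apply: ltnW.
rewrite /free_log_sum -big_filter -/r -[leRHS]big_filter.
have -> : (1 + c%:R^-1) * \sum_(i <- r) (i%:R^-1 : R) =
    \sum_(i <- r ++ map (muln c) r) i%:R^-1.
  rewrite big_cat big_map /= mulrDl mul1r big_distrr /=; congr (_ + _).
  by apply: eq_bigr => i _; rewrite natrM invfM.
apply: ler_sum_subseq.
- by move=> i; rewrite invr_ge0 ler0n.
- rewrite cat_uniq map_inj_uniq; last by move=> x y /eqP; rewrite eqn_pmul2l // => /eqP.
  rewrite filter_uniq ?iota_uniq //= andbT; apply/hasPn => i /mapP[j _ ->].
  by apply/negP; rewrite mem_filter /= dvdn_mulr.
- by rewrite filter_uniq ?iota_uniq.
move=> i; rewrite mem_cat => /orP[|/mapP[j + ->]]; rewrite !mem_filter /= !mem_index_iota.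
  move=> /andP[/andP[_ ->]] /andP[-> /= le]; apply: leq_trans le _.
  by rewrite ltnS leq_pmull.
move=> /andP[/andP[_ fj]] /andP[j1 jn]; rewrite muln_gt0 c0 j1 /= !ltnS.
rewrite leq_pmul2l // -ltnS jn andbT; apply/allP => d ds.
by rewrite Gauss_dvdr ?(allP fj) // coprime_sym (allP cs).
Qed.

Lemma harmonic_sum_le (R : realType) (n : nat) : (0 < n)%N ->
  \sum_(1 <= j < n.+1) (j%:R : R)^-1 <= 1 + ln n%:R.
Proof.
elim: n => // -[_ _|n IH _]; first by rewrite big_nat1 ln1 addr0 invr1.
rewrite big_nat_recr //=; have {}IH := IH isT.
apply: le_trans (lerD IH (lexx _)) _; rewrite -addrA lerD2l.
have p1 : 0 < n.+1%:R :> R by rewrite ltr0n.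
have p2 : 0 < n.+2%:R :> R by rewrite ltr0n.
(* The increment is bounded by [ln (1 + x) <= x] at [x = - n.+2%:R^-1]. *)
rewrite -lerBrDl -lerN2 opprB -ln_div ?posrE //.
have -> : n.+1%:R / n.+2%:R = 1 + - n.+2%:R^-1 :> R.
  by rewrite -[n.+1%:R](addrK 1) natr1 mulrBl mul1r divff ?gt_eqF.
apply: le_ln1Dx; rewrite ltrN2 invf_lt1 // ltr1n //.
Qed.

(** Each element [c] removed from the list replaces [n] by [c * n], whence the product inside the
    logarithm. The factors [1 + c%:R^-1] are expanded and their cross terms dropped. *)
Lemma free_log_sum_le (R : realType) (s : seq nat) (n : nat) :
  (0 < n)%N -> pairwise coprime s -> all (leq 2) s ->
  (1 + \sum_(c <- s) c%:R^-1) * free_log_sum R s n <=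
    1 + ln (n * \prod_(c <- s) c)%:R.
Proof.
elim: s n => [|c s IH] n n0 /=.
  by move=> _ _; rewrite !big_nil muln1 addr0 mul1r; exact: harmonic_sum_le.
move=> /andP[cs ps] /andP[c1 s1].
have c0 : (0 < c)%N by apply: ltnW.
have f0 t m : 0 <= free_log_sum R t m.
  by apply: sumr_ge0 => i _; rewrite invr_ge0 ler0n.
have s0 : 0 <= \sum_(j <- s) (j%:R : R)^-1.
  by apply: sumr_ge0 => i _; rewrite invr_ge0 ler0n.
have ci : 0 <= (c%:R : R)^-1 by rewrite invr_ge0 ler0n.
rewrite !big_cons mulnA [(n * c)%N]mulnC.
apply: le_trans (IH (c * n)%N _ ps s1); last by rewrite muln_gt0 c0 n0.
have := free_log_sum_cons R c s n c1 cs.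
set u := free_log_sum _ _ _; set v := free_log_sum _ _ _ => uv.
apply: le_trans (ler_wpM2l _ uv); last by rewrite addr_ge0.
rewrite mulrA ler_wpM2r //; first exact: f0.
have := mulr_ge0 ci s0; move: (c%:R^-1) (\sum_(j <- s) _) => x y; lra.
Qed.

Lemma large_finite_sum (R : realType) (B : set nat) (f : nat -> R) (K : R) :
  (\esum_(b in B) (f b)%:E = +oo)%E ->
  exists s : seq nat, [/\ uniq s, forall b, b \in s -> B b & K <= \sum_(b <- s) f b].
Proof.
move=> Boo; apply: contrapT => H.
have : (\esum_(b in B) (f b)%:E <= K%:E)%E.
  apply: ub_ereal_sup => _ [X [finX XB] <-].
  rewrite fsbig_finite //= sumEFin lee_fin; apply: ltW; rewrite ltNge.
  apply/negP => KX; apply: H; exists (finmap.enum_fset (fset_set X)); split; rewrite ?finmap.fset_uniq //.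
  by move=> b; rewrite in_fset_set // inE => /XB.
by rewrite Boo.
Qed.

Lemma log_density_coprime (R : realType) (B : set nat) :
  (forall b, B b -> (1 < b)%N) ->
  (forall a b, B a -> B b -> a != b -> coprime a b) ->
  (\esum_(b in B) ((b%:R : R)^-1)%:E = +oo)%E ->
  log_density R (free_set B) = 0.
Proof.
move=> B1 Bco Boo; apply: cvg_lim; first exact: Rhausdorff.
(* The 2 pays for the constant [1 + ln P%:R], which is at most [ln n%:R] for large [n]. *)
apply/cvgrPdist_le => e e0; pose K : R := 2 / e.
have [s [us sB se]] := large_finite_sum R B _ K Boo.
have s1 : all (leq 2) s by apply/allP => c /sB /B1.
have ps : pairwise coprime s.
  have : pairwise [rel x y | x != y] s by rewrite -uniq_pairwise.
  apply: (@sub_in_pairwise _ (mem s)); last exact/allP.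
  by move=> x y /sB Bx /sB By; exact: Bco.
set P := (\prod_(c <- s) c)%N.
near=> n.
have nl : expR (1 + ln P%:R) <= n%:R :> R by near: n; exact: nbhs_infty_ger.
have n1 : (1 < n)%N by near: n; exact: nbhs_infty_gt.
have n0 : (0 < n)%N by apply: ltnW.
have P0 : (0 < P)%N.
  by rewrite /P big_seq prodn_cond_gt0 // => c /sB /B1 /ltnW.
have lnn : 0 < ln n%:R :> R by rewrite ln_gt0 // ltr1n.
have nR0 : 0 < n%:R :> R by rewrite ltr0n.
have lP : 1 + ln P%:R <= ln n%:R :> R.
  by rewrite -[leLHS]expRK ler_ln ?posrE ?expR_gt0.
have f0 : 0 <= free_log_sum R s n.
  by apply: sumr_ge0 => i _; rewrite invr_ge0 ler0n.
have fle : free_log_sum R s n <= e * ln n%:R.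
  have := free_log_sum_le R s n n0 ps s1.
  rewrite natrM lnM ?posrE ?ltr0n // addrCA => H.
  have {}H : K * free_log_sum R s n <= 2 * ln n%:R.
    apply: (@le_trans _ _ ((1 + \sum_(c <- s) c%:R^-1) * free_log_sum R s n)).
      by apply: ler_wpM2r => //; apply: le_trans se _; rewrite lerDr.
    by apply: le_trans H _; rewrite mulr2n mulrDl mul1r lerD2l.
  by move: H; rewrite /K -mulrA ler_pM2l // ler_pdivrMl.
set T := \sum_(_ <= _ < _ | _) _.
have T0 : 0 <= T by apply: sumr_ge0 => i _; rewrite invr_ge0 ler0n.
have Tf : T <= free_log_sum R s n.
  rewrite /T /free_log_sum big_mkcond [leRHS]big_mkcond; apply: ler_sum => j _.
  case: ifP => [|_]; last by case: ifP => // _; rewrite invr_ge0 ler0n.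
  rewrite inE => jF; case: ifP => // /negP; case; apply/allP => c cs.
  by apply/negP => cj; apply: jF; exists c; [exact: sB|rewrite /= dvdzE].
rewrite sub0r normrN ger0_norm ?mulr_ge0 ?invr_ge0 ?(ltW lnn) //.
by rewrite ler_pdivrMl // mulrC (le_trans Tf).
Unshelve. all: by end_near.
Qed.

(** * Closed, shift-invariant and hereditary sets of configurations *)

Lemma closed_coordinate (n : int) (V : set bool) :
  closed [set x : config | V (x n)].
Proof.
have c : continuous (fun x : config => x n : bool).
  exact: (@proj_continuous int (fun _ => bool) n).
by apply: (@preimage_closed config bool (fun x => x n) V) => //; exact: discrete_closed.
Qed.

Lemma shiftZ_invariant (X : set config) :
  (forall j x, X x -> X (shiftZ j x)) -> shiftZ 1 @` X = X.
Proof.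
move=> inv; apply/seteqP; split => [_ [x Xx <-]|x Xx]; first exact: inv.
exists (shiftZ (-1) x); first exact: inv.
by apply/funext => n; rewrite /shiftZ addrK.
Qed.

(** Applied to [admissible B] for the inclusion and to [avoids A] for its strictness. *)
Lemma hereditary_closure_sub (x : config) (X : set config) :
  closed X -> (forall j y, X y -> X (shiftZ j y)) -> hereditary X -> X x ->
  hereditary_closure (orbit_closure x) `<=` X.
Proof.
move=> Xcl inv hX Xx; apply: smallest_sub.
  by split=> //; split=> //; exact: shiftZ_invariant.
rewrite [X in _ `<=` X](closure_id X).1 //; apply: closure_subset.
by move=> _ [j _ <-]; exact: inv.
Qed.

Lemma eta_dvd (B : set nat) (b : nat) (n : int) :
  B b -> eta B n -> ~~ (b%:Z %| n)%Z.
Proof. by rewrite /eta inE => Bb nB; apply/negP => bn; apply: nB; exists b. Qed.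

(** Restricting the missed class to representatives below [b] turns the existential into a finite
    union, which preserves closedness. *)
Lemma admissible_closed (B : set nat) :
  (forall b, B b -> (0 < b)%N) -> closed (admissible B).
Proof.
move=> B0.
suff -> : admissible B = \bigcap_(b in B) \big[setU/set0]_(r <- iota 0 b)
    \bigcap_(n in [set: int]) [set x : config | x n -> (n != r%:Z %[mod b%:Z])%Z].
  apply: closed_bigI => b _; apply: closed_bigsetU => r _.
  apply: closed_bigI => n _.
  exact: (closed_coordinate n [set v : bool | v -> (n != r%:Z %[mod b%:Z])%Z]).
apply/seteqP; split => x H b Bb.
  have [r Hr] := H b Bb.
  have b0 : b%:Z != 0 by rewrite eqz_nat -lt0n B0.
  rewrite -bigcup_seq; exists `|(r %% b)%Z|%N => /=.
    by rewrite mem_iota /= add0n -ltz_nat gez0_abs ?modz_ge0 // ltz_pmod // ltz_nat B0.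
  by move=> n _ /= /Hr; rewrite gez0_abs ?modz_ge0 // modz_mod.
move: (H b Bb); rewrite -bigcup_seq => -[r _ Hr].
by exists r%:Z => n; exact: Hr.
Qed.

Lemma admissible_shift (B : set nat) (j : int) (x : config) :
  admissible B x -> admissible B (shiftZ j x).
Proof.
move=> H b Bb; have [r Hr] := H b Bb; exists (r - j) => n /Hr.
by rewrite !eqz_mod_dvd opprB addrA.
Qed.

Lemma admissible_hereditary (B : set nat) : hereditary (admissible B).
Proof.
move=> x y Hx yx b Bb; have [r Hr] := Hx b Bb; exists r => n yn; apply: Hr.
by move: (yx n); rewrite yn; case: (x n).
Qed.

Lemma admissible_eta (B : set nat) : admissible B (eta B).
Proof.
by move=> b Bb; exists 0 => n /(eta_dvd _ _ _ Bb); rewrite eqz_mod_dvd subr0.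
Qed.

Definition pattern (A : seq nat) : config :=
  fun n : int => has (fun m : nat => n == m%:Z) A.

Definition avoids (A : seq nat) : set config :=
  [set y : config | forall k : int, exists2 n : nat, n \in A & ~~ y (n%:Z + k)].

Lemma avoids_closed (A : seq nat) : closed (avoids A).
Proof.
suff -> : avoids A = \bigcap_(k in [set: int]) \big[setU/set0]_(n <- A)
    [set y : config | ~~ y (n%:Z + k)].
  apply: closed_bigI => k _; apply: closed_bigsetU => n _.
  exact: (closed_coordinate _ [set v : bool | ~~ v]).
apply/seteqP; split => y H k => [_|].
  by rewrite -bigcup_seq; have [n nA yn] := H k; exists n.
by move: (H k I); rewrite -bigcup_seq => -[n nA yn]; exists n.
Qed.

Lemma avoids_shift (A : seq nat) (j : int) (y : config) :
  avoids A y -> avoids A (shiftZ j y).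
Proof.
by move=> H k; have [n nA yn] := H (k + j); exists n; rewrite // /shiftZ -addrA.
Qed.

Lemma avoids_hereditary (A : seq nat) : hereditary (avoids A).
Proof.
move=> x y Hx yx k; have [n nA xn] := Hx k; exists n => //.
by move: (yx (n%:Z + k)); apply: contraTN => ->; move: xn; case: (x _).
Qed.

Lemma pattern_not_avoids (A : seq nat) : ~ avoids A (pattern A).
Proof.
by move=> /(_ 0)[n nA]; rewrite addr0 => /negP; apply; apply/hasP; exists n.
Qed.

Lemma missed_residue (A : seq nat) (c : nat) : (size A < c)%N ->
  exists r : nat, {in A, forall n, (n != r %[mod c])%N}.
Proof.
move=> Ac; have [all_in|] := boolP (all (mem [seq (n %% c)%N | n <- A]) (iota 0 c)).
  have : (size (iota 0 c) <= size [seq (n %% c)%N | n <- A])%N.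
    by apply: uniq_leq_size; [exact: iota_uniq|exact/allP].
  by rewrite size_iota size_map leqNgt Ac.
move=> /allPn[r]; rewrite mem_iota /= add0n => rc rA; exists r => n nA.
by apply: contra rA => /eqP; rewrite [RHS]modn_small // => <-; exact: map_f.
Qed.

Lemma pattern_admissible (B : set nat) (A : seq nat) :
  (forall b, B b -> exists r : nat, {in A, forall n, (n != r %[mod b])%N}) ->
  admissible B (pattern A).
Proof.
move=> H b Bb; have [r Hr] := H b Bb; exists r%:Z => n /hasP[m mA /eqP ->].
by rewrite !modz_nat eqz_nat; exact: Hr.
Qed.

(** * Strictness of the inclusion *)

Lemma proper_of_separating_divisor (B : set nat) (a b q : nat) :
  (forall b, B b -> (0 < b)%N) -> primitive B -> B a -> B b -> a != b ->
  (q %| b)%N -> ~~ (q %| a)%N -> ~~ (gcdn a b %| q)%N ->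
  hereditary_closure (orbit_closure (eta B)) `<` admissible B.
Proof.
move=> B0 Bprim Ba Bb ab qb qna gq.
have nab : ~~ (a %| b)%N by apply: contra ab => /(Bprim _ _ Ba Bb) ->.
have [A [sA Aa Ab Ac Ak]] := obstructing_pattern a b q (B0 _ Ba) (B0 _ Bb) nab qb qna gq.
split.
  apply: hereditary_closure_sub.
  - exact: admissible_closed.
  - exact: admissible_shift.
  - exact: admissible_hereditary.
  - exact: admissible_eta.
move=> H; apply: (pattern_not_avoids A).
apply: (hereditary_closure_sub (eta B)).
- exact: avoids_closed.
- exact: avoids_shift.
- exact: avoids_hereditary.
(* Every translate of [A] contains a multiple of [a] or [b], where [eta B] vanishes. *)
- move=> k; have [n nA] := Ak k; rewrite addrC => kn; exists n => //.
  by apply: contraTN kn => /[dup] /(eta_dvd _ _ _ Ba)/negPf -> /(eta_dvd _ _ _ Bb)/negPf ->.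
apply: H; apply: pattern_admissible => c Bc.
have [cab|] := leqP c (a + b); last first.
  by move=> abc; apply: missed_residue; exact: leq_ltn_trans abc.
have [->|ca] := eqVneq c a.
  by exists 0%N => n nA; rewrite mod0n; exact: Aa.
have [->|cb] := eqVneq c b; first by exists q.
(* A multiple of [c] in [A] would make [c] divide [a] or [b], against primitivity. *)
exists 0%N => n nA; rewrite mod0n; apply/negP => cn.
have c0 : (0 < c <= a + b)%N by rewrite B0.
have /orP[/(Bprim _ _ Bc Ba) e|/(Bprim _ _ Bc Bb) e] := Ac n nA c c0 cn.
- by move: ca; rewrite e eqxx.
- by move: cb; rewrite e eqxx.
Qed.

Theorem corollary1p2 (R : realType) (B : set nat)
    (B_gt1 : forall b : nat, B b -> (1 < b)%N)
    (B_primitive : primitive B)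
    (B_taut : taut R B)
    (B_infinite : infinite_set B)
    (B_not_erdos : ~ erdos R B) :
  hereditary_closure (orbit_closure (eta B)) `<` admissible B.
Proof.
have B0 b : B b -> (0 < b)%N by move=> /B_gt1/ltnW.
have [Bco|] := pselect (forall a b : nat, B a -> B b -> a != b -> coprime a b).
  exfalso; apply: B_not_erdos; split=> //; rewrite ltey; apply/eqP => Boo.
  have /infinite_setN0[b Bb] := B_infinite.
  have := B_taut b Bb; rewrite !log_density_coprime ?ltxx //.
  - by move=> c [/B_gt1].
  - by move=> c d [Bc _] [Bd _]; exact: Bco.
  (* Removing the single finite term at [b] leaves the sum infinite. *)
  move: Boo; rewrite (esumID [set b]); last by move=> i; rewrite lee_fin.
  rewrite (_ : B `&` [set b] = [set b]); last by apply/setIidPr => _ ->.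
  rewrite esum_set1 ?lee_fin // -setDE.
  by case: (\esum_(_ in _) _)%E.
move=> /existsNP[a /existsNP[b /not_implyP[Ba /not_implyP[Bb /not_implyP[ab /negP cab]]]]].
have n x y : B x -> B y -> x != y -> ~~ (x %| y)%N.
  by move=> Bx By; apply: contra => /(B_primitive _ _ Bx By) ->.
have ba : b != a by rewrite eq_sym.
have [[q [? ? ?]]|[q [? ? ?]]] := separating_divisor a b (B0 _ Ba) (B0 _ Bb)
  (n _ _ Ba Bb ab) (n _ _ Bb Ba ba) cab.
- exact: (proper_of_separating_divisor B a b q).
- exact: (proper_of_separating_divisor B b a q).
Qed.
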